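(* Let $\Bbbk$ be an algebraically closed field of characteristic zero and let $J$ be the bosonization of the Jordan plane over the infinite cyclic group (presented in the context). The centre of $J$ is the polynomial algebra $Z(J)=\Bbbk[\Omega]$, where $\Omega=x^2g^{-1}$.
   Context: $J$ is the associative unital $\Bbbk$-algebra generated by $g^{\pm1},x,y$ with defining relations $gg^{-1}=g^{-1}g=1$, $gxg^{-1}=x$, $gyg^{-1}=y+x$, $yx-xy=-\tfrac12x^2$. $Z(J)$ denotes the centre of $J$. *)

(* Defs.v *)
(* MathComp, with the monoid algebras of multinomials for the free algebra. *)
From HB Require Import structures.
From mathcomp Require Import all_boot all_algebra.
From mathcomp Require Import boolp.
From mathcomp Require Import finmap monalg.

Set Implicit Arguments.
Unset Strict Implicit.
Unset Printing Implicit Defensive.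

Import GRing.Theory.
Local Open Scope ring_scope.
Local Open Scope quotient_scope.

Inductive two_sided_ideal (A : nzRingType) (S : A -> Prop) : A -> Prop :=
| tsi_gen a : S a -> two_sided_ideal S a
| tsi_zero : two_sided_ideal S 0
| tsi_sub a b : two_sided_ideal S a -> two_sided_ideal S b ->
    two_sided_ideal S (a - b)
| tsi_mull a b : two_sided_ideal S b -> two_sided_ideal S (a * b)
| tsi_mulr a b : two_sided_ideal S a -> two_sided_ideal S (a * b).

Definition is_central (A : nzRingType) (z : A) : Prop :=
  forall w : A, GRing.comm z w.

Inductive Jgen := gen_g | gen_gV | gen_x | gen_y.

Definition nat_of_Jgen (i : Jgen) : nat :=
  match i with gen_g => 0 | gen_gV => 1 | gen_x => 2 | gen_y => 3 end%N.

Definition Jgen_of_nat (n : nat) : Jgen :=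
  match n with 0%N => gen_g | 1%N => gen_gV | 2%N => gen_x | _ => gen_y end.

Lemma nat_of_JgenK : cancel nat_of_Jgen Jgen_of_nat.
Proof. by case. Qed.

HB.instance Definition _ := Countable.copy Jgen (can_type nat_of_JgenK).

(* [{fmonom Jgen}] is the monoid of words in the four generators, so this is
   the free associative unital algebra on them. *)
Notation Jfree k := {malg k[{fmonom Jgen}]}.

(* Locked because conversion tests between distinct words are very slow. *)
HB.lock Definition fgen (k : fieldType) (i : Jgen) : Jfree k := << fmu i >>.

Section Relations.
Variable k : fieldType.
Local Notation g := (fgen k gen_g).
Local Notation gV := (fgen k gen_gV).
Local Notation x := (fgen k gen_x).
Local Notation y := (fgen k gen_y).

(* [Jrel r] for each defining relation [lhs = rhs], with [r := lhs - rhs]. *)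
Variant Jrel : Jfree k -> Prop :=
| Jrel_ggV : Jrel (g * gV - 1)
| Jrel_gVg : Jrel (gV * g - 1)
| Jrel_gx : Jrel (g * x * gV - x)
| Jrel_gy : Jrel (g * y * gV - (y + x))
| Jrel_yx : Jrel ((y * x - x * y) - (- 2^-1 : k) *: x ^+ 2).
End Relations.

Definition Jideal (k : fieldType) : {pred Jfree k} :=
  fun a => `[< two_sided_ideal (@Jrel k) a >].
Arguments Jideal k _ : clear implicits.

Section JordanAlgebra.
Variable k : fieldType.
Implicit Types (a b : Jfree k) (c : k).

Lemma JidealP a : reflect (two_sided_ideal (@Jrel k) a) (a \in Jideal k).
Proof. exact: asboolP. Qed.

Lemma Jideal_zmod_closed : zmod_closed (Jideal k).
Proof.
split=> [|a b /JidealP ha /JidealP hb]; apply/JidealP; first exact: tsi_zero.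
exact: tsi_sub.
Qed.

HB.instance Definition _ :=
  GRing.isZmodClosed.Build (Jfree k) (Jideal k) Jideal_zmod_closed.

Lemma JidealMl a b : b \in Jideal k -> a * b \in Jideal k.
Proof. by move=> /JidealP hb; apply/JidealP; apply: tsi_mull. Qed.

Lemma JidealMr a b : a \in Jideal k -> a * b \in Jideal k.
Proof. by move=> /JidealP ha; apply/JidealP; apply: tsi_mulr. Qed.

Lemma JidealZ c a : a \in Jideal k -> c *: a \in Jideal k.
Proof. by move=> ha; rewrite -mul_malgC; apply: JidealMl. Qed.

Lemma JfreeZAr c a b : c *: (a * b) = a * (c *: b).
Proof.
apply/malgP => m; rewrite [LHS]mcoeffZ [X in _ * X]mcoeffMl.
rewrite (mcoeffMlw m (fsubset_refl _) (msuppZ_le c b)).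
rewrite mulr_sumr; apply: eq_bigr => m1 _; rewrite mulr_sumr.
by apply: eq_bigr => m2 _; rewrite mcoeffZ mulrnAr mulrCA.
Qed.

(* The counit [g, g^-1 |-> 1], [x, y |-> 0] shows that the quotient is not the
   zero ring, which MathComp requires of an algebra. *)
Definition Jgen_counit (i : Jgen) : k :=
  match i with gen_g | gen_gV => 1 | gen_x | gen_y => 0 end.

Definition fmonom_counit (m : {fmonom Jgen}) : k :=
  \prod_(i <- (m : seq Jgen)) Jgen_counit i.

Lemma fmonom_counit_mmorphism : mmorphism fmonom_counit.
Proof.
by split=> [m1 m2|]; rewrite /fmonom_counit ?fmM ?big_cat // fm1 big_nil.
Qed.

HB.instance Definition _ := isMultiplicative.Build {fmonom Jgen} k
  fmonom_counit fmonom_counit_mmorphism.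

Definition Jcounit : {rmorphism Jfree k -> k} := mmap idfun fmonom_counit.

Lemma Jcounit_gen i : Jcounit (fgen k i) = Jgen_counit i.
Proof.
by rewrite /Jcounit /= fgen.unlock mmapU /= mul1r /fmonom_counit fmU big_seq1.
Qed.

Lemma JcounitZ c a : Jcounit (c *: a) = c * Jcounit a.
Proof. exact: mmapZ. Qed.

Lemma Jcounit_ideal a : two_sided_ideal (@Jrel k) a -> Jcounit a = 0.
Proof.
elim=> {a} [a||a b _ ha _ hb|a b _ hb|a b _ ha].
- case.
  - by rewrite rmorphB rmorphM rmorph1 !Jcounit_gen mulr1 subrr.
  - by rewrite rmorphB rmorphM rmorph1 !Jcounit_gen mulr1 subrr.
  - by rewrite rmorphB !rmorphM !Jcounit_gen mulr1 mul1r subrr.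
  - by rewrite rmorphB rmorphD !rmorphM !Jcounit_gen mulr1 mul1r addr0 subrr.
  - rewrite rmorphB JcounitZ rmorphXn [X in X - _]rmorphB.
    rewrite [X in X - _ - _]rmorphM [X in _ - X - _]rmorphM !Jcounit_gen.
    by rewrite expr0n !mulr0 !subr0.
- exact: rmorph0.
- by rewrite rmorphB ha hb subr0.
- by rewrite rmorphM hb mulr0.
- by rewrite rmorphM ha mul0r.
Qed.

Lemma Jideal_proper : 1 \notin Jideal k.
Proof.
by apply/negP => /JidealP /Jcounit_ideal/eqP; rewrite rmorph1 oner_eq0.
Qed.

Definition J := Quotient.quot (Jideal k).
HB.instance Definition _ := GRing.Zmodule.on J.
HB.instance Definition _ := generic_quotient.Quotient.on J.

Lemma Jpi_eq a b : (\pi_J a = \pi_J b) <-> (a - b \in Jideal k).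
Proof. by rewrite Quotient.idealrBE; split=> [->|/eqP]. Qed.

Definition Jone : J := \pi_J 1.
Definition Jmul (u v : J) : J := \pi_J (repr u * repr v).
Definition Jscale (c : k) (u : J) : J := \pi_J (c *: repr u).

Lemma Jrepr_pi a : repr (\pi_J a) - a \in Jideal k.
Proof. by apply/Jpi_eq; rewrite reprK. Qed.

Lemma Jpi_mul a b : \pi_J (a * b) = Jmul (\pi_J a) (\pi_J b).
Proof.
apply/esym/Jpi_eq; set a' := repr _; set b' := repr _.
have -> : a' * b' - a * b = (a' - a) * b' + a * (b' - b).
  by rewrite mulrBl mulrBr addrA subrK.
apply: rpredD; [apply: JidealMr | apply: JidealMl]; exact: Jrepr_pi.
Qed.

Lemma Jpi_scale c a : \pi_J (c *: a) = Jscale c (\pi_J a).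
Proof.
by apply/esym/Jpi_eq; rewrite -scalerBr; apply: JidealZ; exact: Jrepr_pi.
Qed.

Lemma Jpi_add a b : \pi_J (a + b) = \pi_J a + \pi_J b.
Proof. exact: Quotient.pi_add. Qed.

Lemma Jpi_surj (u : J) : exists a, u = \pi_J a.
Proof. by exists (repr u); rewrite reprK. Qed.

Lemma JmulA : associative Jmul.
Proof.
move=> u v w; have [a ->] := Jpi_surj u; have [b ->] := Jpi_surj v.
by have [d ->] := Jpi_surj w; rewrite -!Jpi_mul mulrA.
Qed.

Lemma Jmul1 : left_id Jone Jmul.
Proof. by move=> u; have [a ->] := Jpi_surj u; rewrite -Jpi_mul mul1r. Qed.

Lemma Jmulr1 : right_id Jone Jmul.
Proof. by move=> u; have [a ->] := Jpi_surj u; rewrite -Jpi_mul mulr1. Qed.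

Lemma JmulDl : left_distributive Jmul +%R.
Proof.
move=> u v w; have [a ->] := Jpi_surj u; have [b ->] := Jpi_surj v.
have [d ->] := Jpi_surj w.
by rewrite -Jpi_add -!Jpi_mul mulrDl Jpi_add.
Qed.

Lemma JmulDr : right_distributive Jmul +%R.
Proof.
move=> u v w; have [a ->] := Jpi_surj u; have [b ->] := Jpi_surj v.
have [d ->] := Jpi_surj w.
by rewrite -Jpi_add -!Jpi_mul mulrDr Jpi_add.
Qed.

Lemma Jone_neq0 : Jone != 0.
Proof.
have pi0 : \pi_J 0 = 0 by apply: (addrI (\pi_J 0)); rewrite -Jpi_add !addr0.
apply/eqP; rewrite -pi0 => /Jpi_eq; rewrite subr0.
by rewrite (negPf Jideal_proper).
Qed.

HB.instance Definition _ :=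
  GRing.Zmodule_isNzRing.Build J JmulA Jmul1 Jmulr1 JmulDl JmulDr Jone_neq0.

Lemma JscaleA c d u : Jscale c (Jscale d u) = Jscale (c * d) u.
Proof. by have [a ->] := Jpi_surj u; rewrite -!Jpi_scale scalerA. Qed.

Lemma Jscale1 : left_id 1 Jscale.
Proof. by move=> u; have [a ->] := Jpi_surj u; rewrite -Jpi_scale scale1r. Qed.

Lemma JscaleDr : right_distributive Jscale +%R.
Proof.
move=> c u v; have [a ->] := Jpi_surj u; have [b ->] := Jpi_surj v.
by rewrite -Jpi_add -!Jpi_scale scalerDr Jpi_add.
Qed.

Lemma JscaleDl u : {morph Jscale^~ u : c d / c + d}.
Proof.
move=> c d; have [a ->] := Jpi_surj u.
by rewrite -!Jpi_scale scalerDl Jpi_add.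
Qed.

HB.instance Definition _ :=
  GRing.Zmodule_isLmodule.Build k J JscaleA Jscale1 JscaleDr JscaleDl.

Lemma JscaleAl c (u v : J) : c *: (u * v) = (c *: u) * v.
Proof.
have [a ->] := Jpi_surj u; have [b ->] := Jpi_surj v.
change (Jscale c (Jmul (\pi_J a) (\pi_J b))
        = Jmul (Jscale c (\pi_J a)) (\pi_J b)).
by rewrite -Jpi_mul -!Jpi_scale -Jpi_mul scalerAl.
Qed.

HB.instance Definition _ := GRing.Lmodule_isLalgebra.Build k J JscaleAl.

Lemma JscaleAr c (u v : J) : c *: (u * v) = u * (c *: v).
Proof.
have [a ->] := Jpi_surj u; have [b ->] := Jpi_surj v.
change (Jscale c (Jmul (\pi_J a) (\pi_J b))
        = Jmul (\pi_J a) (Jscale c (\pi_J b))).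
by rewrite -Jpi_mul -!Jpi_scale -Jpi_mul JfreeZAr.
Qed.

HB.instance Definition _ := GRing.Lalgebra_isAlgebra.Build k J JscaleAr.

(* [JgV] is the generator [g^-1]; [J] carries no [unitRingType] structure. *)
Definition Jg : J := \pi_J (fgen k gen_g).
Definition JgV : J := \pi_J (fgen k gen_gV).
Definition Jx : J := \pi_J (fgen k gen_x).
Definition Jy : J := \pi_J (fgen k gen_y).

Definition Omega : J := Jx ^+ 2 * JgV.

End JordanAlgebra.

(* Main.v *)
Require Import Defs.
From HB Require Import structures.
From mathcomp Require Import all_boot all_algebra.
From mathcomp Require Import finmap monalg zify.

Set Implicit Arguments.
Unset Strict Implicit.
Unset Printing Implicit Defensive.

Import GRing.Theory.
Local Open Scope ring_scope.
Local Open Scope quotient_scope.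

(** Moving [y] to the right past [x] or [g] creates only terms with fewer
    [y]'s: from the relations,
      [y (x^a g^n) = (x^a g^n) y - (n + a/2) x^(a+1) g^n].
    Hence the monomials [x^a g^n y^b], with [a], [b] natural numbers and [n] an
    integer, span [J]. They are also linearly independent: the formulas for
    left multiplication by the generators define operators on the vector space
    freely spanned by the symbols [x^a g^n y^b], these operators satisfy the
    relations ([free_act_rel]), and in the resulting [J]-module the element
    [x^a g^n y^b] sends the symbol [1] to the symbol [x^a g^n y^b]
    ([normal_form_xgy]). So every element of [J] has a unique normal form, and
    [J] is an Ore extension of [k[x, g, g^-1]] by [y].

    Let [z] be central. If [b > 0] is its degree in [y], then the leading part
    [f y^b] contributes [- (b/2) x^2 f y^(b-1)] to the commutator of [z] with
    [x], and nothing else has that degree ([mcoeff_commutator_x]). In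
    characteristic zero this forces [f = 0], so [z] is a combination of
    monomials [x^a g^n] ([normal_form_central]). The commutator of [y] with
    [x^a g^n] is [- (n + a/2) x^(a+1) g^n], and these are independent for
    distinct [(a, n)], so only the pairs with [a = - 2 n] occur
    ([normal_form_central_support]). Those monomials are exactly the powers
    of [Omega] ([OmegaX]).

    Conversely [Omega] commutes with [x] and [g] clearly, and with [y] because
    its weight [- 1 + 2/2] vanishes. The powers of [Omega] being distinct basis
    monomials, evaluation of polynomials at [Omega] is injective. *)

(** * Linear maps out of a free module *)

Section MalgLift.
Variables (R : comNzRingType) (K : choiceType) (W : lmodType R).
Implicit Types (f : K -> W) (v : {malg R[K]}).

Definition malg_lift f v : W := \sum_(t <- msupp v) v@_t *: f t.

Lemma malg_liftEw f v (d : {fset K}) :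
  (msupp v `<=` d)%fset -> malg_lift f v = \sum_(t <- d) v@_t *: f t.
Proof.
move=> le; rewrite /malg_lift (big_fset_incl _ le) // => t _ tNv.
by rewrite mcoeff_outdom // scale0r.
Qed.

Lemma malg_lift_linear f : linear (malg_lift f).
Proof.
move=> c u v; pose d := (msupp u `|` msupp v)%fset.
have leu : (msupp u `<=` d)%fset by apply: fsubsetUl.
have lev : (msupp v `<=` d)%fset by apply: fsubsetUr.
have leuv : (msupp (c *: u + v) `<=` d)%fset.
  apply: fsubset_trans (msuppD_le _ _) _; rewrite fsubUset lev andbT.
  exact: fsubset_trans (msuppZ_le _ _) leu.
rewrite (malg_liftEw f leu) (malg_liftEw f lev) (malg_liftEw f leuv).
rewrite scaler_sumr -big_split; apply: eq_bigr => t _ /=.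
by rewrite mcoeffD mcoeffZ scalerDl scalerA.
Qed.

HB.instance Definition _ f :=
  GRing.isLinear.Build R {malg R[K]} W *:%R (malg_lift f) (malg_lift_linear f).

Lemma malg_liftU f c t : malg_lift f << c *g t >> = c *: f t.
Proof.
by rewrite (malg_liftEw f (msuppU_le (k := t))) big_seq_fset1 mcoeffUU.
Qed.

Lemma malg_liftU1 f t : malg_lift f << t >> = f t.
Proof. by rewrite malg_liftU scale1r. Qed.

Lemma malg_sumZ v : v = \sum_(t <- msupp v) v@_t *: << t >>.
Proof.
rewrite [LHS]monalgE; apply: eq_bigr => t _; apply/malgP => s.
by rewrite mcoeffZ !mcoeffU mulrnAr mulr1.
Qed.

Lemma malg_linear_eq (f h : {linear {malg R[K]} -> W}) :
  (forall t, f << t >> = h << t >>) -> f =1 h.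
Proof.
move=> fh v; rewrite (malg_sumZ v) !linear_sum; apply: eq_bigr => t _.
by rewrite !linearZ fh.
Qed.

End MalgLift.

(** * The module of formal normal forms *)

Local Notation pbw := (nat * int * nat)%type.

(** The formal monomial that stands for [x^a g^n y^b]. *)
(* Locked, here and below: unification would otherwise unfold distinct
   monomials down to their underlying finitely supported functions. *)
HB.lock Definition mon (k : fieldType) (a : nat) (n : int) (b : nat) :
  {malg k[pbw]} := << (a, n, b) >>.

(** The eigenvalue on [x^a g^n] of the derivation of the commutative algebra
    [k[x, g^-1, g]] that sends [x] to [x/2] and [g] to [g]; commuting [y] past
    [x^a g^n] costs [x] times this scalar. *)
HB.lock Definition weight (k : fieldType) (a : nat) (n : int) : k :=
  n%:~R + a%:R / 2.

(** Left multiplication of [x^a g^n y^b] by a generator, rewritten in the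
    same form: these formulas define a module from which the linear
    independence of the [x^a g^n y^b] in [J] will follow. *)
Definition gen_mon (k : fieldType) (i : Jgen) (t : pbw) : {malg k[pbw]} :=
  let: (a, n, b) := t in
  match i with
  | gen_g => mon k a (n + 1) b
  | gen_gV => mon k a (n - 1) b
  | gen_x => mon k a.+1 n b
  | gen_y => mon k a n b.+1 - weight k a n *: mon k a.+1 n b
  end.

HB.lock Definition gen_act (k : fieldType) (i : Jgen) :
  {malg k[pbw]} -> {malg k[pbw]} := malg_lift (gen_mon k i).

Section NormalForm.
Variable k : fieldType.
Local Notation V := {malg k[pbw]}.
Local Notation mon := (@mon k).
Local Notation weight := (@weight k).
Local Notation gen_act := (@gen_act k).
Implicit Types (v : V) (z : J k).

Lemma gen_act_linear i : linear (gen_act i).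
Proof. by rewrite gen_act.unlock; exact: malg_lift_linear. Qed.
HB.instance Definition _ i :=
  GRing.isLinear.Build k V V *:%R (gen_act i) (gen_act_linear i).

Lemma gen_actE :
  (forall a n b, gen_act gen_g (mon a n b) = mon a (n + 1) b) *
  (forall a n b, gen_act gen_gV (mon a n b) = mon a (n - 1) b) *
  (forall a n b, gen_act gen_x (mon a n b) = mon a.+1 n b) *
  (forall a n b, gen_act gen_y (mon a n b)
                 = mon a n b.+1 - weight a n *: mon a.+1 n b).
Proof.
rewrite gen_act.unlock; (do !split)=> a n b;
  by rewrite {1}mon.unlock malg_liftU1.
Qed.

Definition word_act (w : seq Jgen) (v : V) : V := foldr gen_act v w.

Lemma word_act_linear w : linear (word_act w).
Proof.
elim: w => [|i w IH] c u v //.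
by rewrite -[LHS]/(gen_act i (word_act w _)) IH linearP.
Qed.
HB.instance Definition _ w :=
  GRing.isLinear.Build k V V *:%R (word_act w) (word_act_linear w).

Definition free_act (v : V) : Jfree k -> V :=
  malg_lift (fun m : {fmonom Jgen} => word_act m v).
HB.instance Definition _ v := GRing.Linear.on (free_act v).

Lemma free_actU v c (m : {fmonom Jgen}) :
  free_act v << c *g m >> = c *: word_act m v.
Proof. exact: malg_liftU. Qed.

Lemma free_act1 v : free_act v 1 = v.
Proof. by rewrite -mpolyC1E free_actU scale1r fm1. Qed.

Lemma free_act_gen v i : free_act v (fgen k i) = gen_act i v.
Proof. by rewrite fgen.unlock free_actU scale1r fmU. Qed.

Lemma free_act_linear a : linear (free_act^~ a).
Proof.
move=> c u v; rewrite /free_act /malg_lift scaler_sumr -big_split.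
by apply: eq_bigr => m _; rewrite linearP scalerDr !scalerA mulrC.
Qed.

Lemma free_actM v a b : free_act v (a * b) = free_act (free_act v b) a.
Proof.
rewrite malgME linear_sum [RHS]/free_act /malg_lift; apply: eq_bigr => m _.
rewrite linear_sum [in RHS](monalgE b) (linear_sum (free_act v)).
rewrite (linear_sum (word_act m)) scaler_sumr; apply: eq_bigr => m' _.
rewrite /= !free_actU linearZ /= scalerA; congr (_ *: _).
by rewrite fmM /word_act foldr_cat.
Qed.

Lemma weight_succ_g a n : weight a (n + 1) = weight a n + 1.
Proof. by rewrite weight.unlock intrD addrAC. Qed.

Lemma weight_succ_x a n : weight a.+1 n = weight a n + 2^-1.
Proof. by rewrite weight.unlock -natr1 mulrDl mul1r addrA. Qed.

Lemma mon_ext (f h : V -> V) (lf : linear f) (lh : linear h) :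
  (forall a n b, f (mon a n b) = h (mon a n b)) -> f =1 h.
Proof.
move=> fh.
pose F : {linear V -> V} := HB.pack f (GRing.isLinear.Build k V V *:%R f lf).
pose H : {linear V -> V} := HB.pack h (GRing.isLinear.Build k V V *:%R h lh).
by apply: (@malg_linear_eq _ _ _ F H) => -[[a n] b];
  have := fh a n b; rewrite mon.unlock.
Qed.

Lemma free_actB v a b : free_act v (a - b) = free_act v a - free_act v b.
Proof. exact: linearB. Qed.

Lemma free_actD v a b : free_act v (a + b) = free_act v a + free_act v b.
Proof. exact: linearD. Qed.

Lemma free_actZ v c a : free_act v (c *: a) = c *: free_act v a.
Proof. exact: linearZ. Qed.

Lemma free_act_commutator v a b c :
  free_act v (a * b - b * a - c *: b ^+ 2) =
  free_act (free_act v b) a - free_act (free_act v a) b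
  - c *: free_act (free_act v b) b.
Proof.
have split3 p q r : free_act v (p - q - c *: r) =
    free_act v p - free_act v q - c *: free_act v r.
  by rewrite !free_actB free_actZ.
have cong3 (p p' q q' r r' : V) : p = p' -> q = q' -> r = r' ->
    p - q - c *: r = p' - q' - c *: r'.
  by move=> -> -> ->.
apply: etrans (split3 _ _ _) _; rewrite expr2.
(* Rewriting with free_actM would compare a * b with b * a by conversion. *)
exact: (cong3 _ _ _ _ _ _
  (free_actM v a b) (free_actM v b a) (free_actM v b b)).
Qed.

(** The five relations hold because [weight] grows by [1] under [g] and by
    [1/2] under [x]. *)
Lemma free_act_rel v a : Jrel a -> free_act v a = 0.
Proof.
move=> ra; move: v.
apply: (mon_ext (free_act_linear a) (h := fun=> 0)).
  by move=> c u v; rewrite scaler0 addr0.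
move=> a0 n b; case: ra.
- rewrite free_actB free_actM free_act1 !free_act_gen.
  by rewrite !gen_actE subrK subrr.
- rewrite free_actB free_actM free_act1 !free_act_gen.
  by rewrite !gen_actE addrK subrr.
- rewrite free_actB !free_actM !free_act_gen.
  by rewrite !gen_actE subrK subrr.
- rewrite free_actB free_actD !free_actM !free_act_gen.
  rewrite !gen_actE linearB linearZ /= !gen_actE !subrK.
  have -> : weight a0 n = weight a0 (n - 1) + 1.
    by rewrite -weight_succ_g subrK.
  by apply/eqP; rewrite subr_eq0 scalerDl scale1r opprD addrA subrK.
- rewrite free_act_commutator !free_act_gen.
  rewrite !gen_actE [gen_act _ (_ - _)]linearB /=
    [gen_act _ (_ *: _)]linearZ /= !gen_actE weight_succ_x.
  rewrite scalerDl scaleNr opprK.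
  by rewrite !opprD opprK addrACA addrN add0r addrAC subrK addNr.
Qed.

Lemma free_act_ideal v a : two_sided_ideal (@Jrel k) a -> free_act v a = 0.
Proof.
move=> Ia; elim: Ia v => {a} [a ra|| a b _ IHa _ IHb | a b _ IHb | a b _ IHa] v.
- exact: free_act_rel.
- exact: linear0.
- by rewrite linearB /= IHa IHb subr0.
- rewrite free_actM IHb /free_act /malg_lift.
  by apply: big1 => m _; rewrite linear0 scaler0.
- by rewrite free_actM IHa.
Qed.

Definition J_act z v : V := free_act v (repr z).

Lemma J_act_pi a v : J_act (\pi_(J k) a) v = free_act v a.
Proof.
apply/eqP; rewrite -subr_eq0 -linearB /= free_act_ideal //.
exact/JidealP/Jrepr_pi.
Qed.

Lemma J_actM z z' v : J_act (z * z') v = J_act z (J_act z' v).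
Proof.
have [a ->] := Jpi_surj z; have [b ->] := Jpi_surj z'.
by rewrite -[_ * _]/(Jmul _ _) -Jpi_mul !J_act_pi free_actM.
Qed.

Lemma J_act1 v : J_act 1 v = v.
Proof. by rewrite -[1]/(\pi_(J k) 1) J_act_pi free_act1. Qed.

Lemma J_act_linearl v : linear (J_act^~ v).
Proof.
move=> c z z'; have [a ->] := Jpi_surj z; have [b ->] := Jpi_surj z'.
by rewrite -[_ *: _]/(Jscale _ _) -Jpi_scale -Jpi_add !J_act_pi linearP.
Qed.

Lemma J_act_linear z : linear (J_act z).
Proof. exact: free_act_linear. Qed.

HB.instance Definition _ z :=
  GRing.isLinear.Build k V V *:%R (J_act z) (J_act_linear z).

Lemma J_actD z u v : J_act z (u + v) = J_act z u + J_act z v.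
Proof. exact: linearD. Qed.

Lemma J_actB z u v : J_act z (u - v) = J_act z u - J_act z v.
Proof. exact: linearB. Qed.

Lemma J_actZ z c v : J_act z (c *: v) = c *: J_act z v.
Proof. exact: linearZ. Qed.

Definition Jgenerator i : J k := \pi_(J k) (fgen k i).

Lemma J_act_gen i v : J_act (Jgenerator i) v = gen_act i v.
Proof. by rewrite J_act_pi free_act_gen. Qed.

(** [J] is spanned by words in the generators, and words are built by left
    multiplication. *)
Lemma J_ind (P : J k -> Prop) :
  P 0 -> P 1 -> (forall i z, P z -> P (Jgenerator i * z)) ->
  (forall c z z', P z -> P z' -> P (c *: z + z')) -> forall z, P z.
Proof.
move=> P0 P1 PM PD z; have [a ->] := Jpi_surj z; rewrite (malg_sumZ a).
elim/big_rec: _ => [|m b _ Pb].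
  suff -> : \pi_(J k) 0 = 0 by [].
  by apply: (addrI (\pi_(J k) 0)); rewrite -Jpi_add !addr0.
rewrite Jpi_add Jpi_scale; apply: PD => //; rewrite -[m]fmK.
elim: (m : seq _) => [|i w IH].
  have -> : << FMonom [::] >> = 1 :> Jfree k by rewrite -mpolyC1E -fmoneE.
  exact: P1.
have -> : << FMonom (i :: w) >> = fgen k i * << FMonom w >> :> Jfree k.
  rewrite fgen.unlock malgM_def fgmulUU mulr1; congr << _ *g _ >>.
  by apply/eqP; rewrite fmP fmM fmU.
rewrite Jpi_mul; exact: PM.
Qed.

End NormalForm.

(** * Normal ordering from the defining relations *)

(** Normal ordering uses nothing but the relations, so it takes place in an
    arbitrary algebra; linear independence is what will be specific to [J]. *)
Record jordan_relations (k : fieldType) (A : algType k) (g gV x y : A) : Prop :=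
  JordanRelations {
    mul_ggV : g * gV = 1;
    mul_gVg : gV * g = 1;
    conj_x : g * x * gV = x;
    conj_y : g * y * gV = y + x;
    commutator_yx : y * x - x * y = (- 2^-1 : k) *: x ^+ 2 }.

Section Relations.
Variables (k : fieldType) (A : algType k) (g gV x y : A).
Variable rel : jordan_relations g gV x y.
Local Notation V := {malg k[pbw]}.
Local Notation mon := (@mon k).
Local Notation weight := (@weight k).
Implicit Types (u z : A) (v : V).

Let mulggV : g * gV = 1 := mul_ggV rel.
Let mulgVg : gV * g = 1 := mul_gVg rel.

Lemma comm_xg : GRing.comm x g.
Proof.
by rewrite /GRing.comm -{1}(conj_x rel) -[LHS]mulrA mulgVg mulr1.
Qed.

Lemma comm_xgV : GRing.comm x gV.
Proof.
rewrite /GRing.comm -[LHS]mul1r -mulgVg -[LHS]mulrA [g * _]mulrA.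
by rewrite (conj_x rel).
Qed.

Lemma mulgy : g * y = y * g + x * g.
Proof. by rewrite -mulrDl -(conj_y rel) -[RHS]mulrA mulgVg mulr1. Qed.

Lemma mulyx : y * x = x * y - 2^-1 *: x ^+ 2.
Proof.
apply/eqP; rewrite addrC -subr_eq; apply/eqP.
by rewrite (commutator_yx rel) scaleNr.
Qed.

(** Such [u] behave like eigenvectors of the derivation [ad y], up to the
    factor [x]; they are closed under products, the eigenvalues adding up, so
    it suffices to know the eigenvalues of [x], [g] and [g^-1]. *)
Definition y_weight u (e : k) := GRing.comm x u /\ y * u = u * y - e *: (x * u).

Lemma y_weight1 : y_weight 1 0.
Proof. by split; [exact: commr1 | rewrite scale0r subr0 mulr1 mul1r]. Qed.

Lemma y_weightM u u' e e' :
  y_weight u e -> y_weight u' e' -> y_weight (u * u') (e + e').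
Proof.
move=> [cu yu] [cu' yu']; split; first exact: commrM.
rewrite mulrA yu mulrBl -!mulrA yu' mulrBr -!scalerAr -!scalerAl -!mulrA.
by rewrite [u * (x * u')]mulrA -cu -mulrA scalerDl opprD addrA addrAC.
Qed.

Lemma y_weightX u e n : y_weight u e -> y_weight (u ^+ n) (e *+ n).
Proof.
move=> ue; elim: n => [|n IH]; first exact: y_weight1.
by rewrite exprS mulrS; apply: y_weightM.
Qed.

Lemma y_weight_x : y_weight x 2^-1.
Proof. by split=> //; exact: mulyx. Qed.

Lemma y_weight_g : y_weight g 1.
Proof. by split; [exact: comm_xg | rewrite scale1r mulgy addrK]. Qed.

Lemma y_weight_gV : y_weight gV (-1).
Proof.
split; first exact: comm_xgV.
rewrite scaleN1r opprK -[LHS]mul1r -mulgVg -mulrA [g * _]mulrA mulgy mulrDl.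
by rewrite -!mulrA mulggV !mulr1 mulrDr comm_xgV.
Qed.

Definition gpow (n : int) : A :=
  match n with Posz m => g ^+ m | Negz m => gV ^+ m.+1 end.

Lemma mulg_gpow n : g * gpow n = gpow (n + 1).
Proof.
case: n => [m|[|m]] /=.
- by rewrite addn1 exprS.
- by rewrite expr1 mulggV.
- by rewrite [gV ^+ m.+2]exprS mulrA mulggV mul1r subn1.
Qed.

Lemma mulgV_gpow n : gV * gpow n = gpow (n - 1).
Proof. by rewrite -{1}[n](subrK 1) -mulg_gpow mulrA mulgVg mul1r. Qed.

Lemma gpowN (m : nat) : gpow (- m%:Z) = gV ^+ m.
Proof. by case: m => [|m]. Qed.

Lemma y_weight_gpow n : y_weight (gpow n) n%:~R.
Proof.
case: n => m; first exact: (y_weightX m y_weight_g).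
by rewrite NegzE mulrNz; have := y_weightX m.+1 y_weight_gV; rewrite mulNrn.
Qed.

Definition xgy a n b : A := x ^+ a * gpow n * y ^+ b.

Lemma y_weight_xgpow a n : y_weight (x ^+ a * gpow n) (weight a n).
Proof.
rewrite weight.unlock addrC mulr_natl.
exact: y_weightM (y_weightX a y_weight_x) (y_weight_gpow n).
Qed.

Definition pbw_eval : V -> A :=
  malg_lift (fun t : pbw => let: (a, n, b) := t in xgy a n b).
HB.instance Definition _ := GRing.Linear.on pbw_eval.

Lemma pbw_eval_mon a n b : pbw_eval (mon a n b) = xgy a n b.
Proof. by rewrite mon.unlock /pbw_eval malg_liftU1. Qed.

Lemma mon_sum v : v = \sum_(t <- msupp v) v@_t *: mon t.1.1 t.1.2 t.2.
Proof.
rewrite [LHS]malg_sumZ; apply: eq_bigr => -[[a n] b] _.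
by rewrite mon.unlock.
Qed.

Definition jgen i :=
  match i with gen_g => g | gen_gV => gV | gen_x => x | gen_y => y end.

(** The formulas of [gen_mon] are what left multiplication does in [A]. *)
Lemma pbw_eval_gen i v : pbw_eval (gen_act i v) = jgen i * pbw_eval v.
Proof.
rewrite [v]mon_sum !linear_sum /= mulr_sumr; apply: eq_bigr => -[[a n] b] _ /=.
rewrite !linearZ /= -scalerAr; congr (_ *: _); rewrite pbw_eval_mon /xgy.
case: i; rewrite !gen_actE ?linearB ?linearZ /= !pbw_eval_mon /xgy !mulrA.
- rewrite [g * _](commrX a (commr_sym comm_xg)).
  by rewrite -[_ * g * _]mulrA mulg_gpow.
- rewrite [gV * _](commrX a (commr_sym comm_xgV)).
  by rewrite -[_ * gV * _]mulrA mulgV_gpow.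
- by rewrite exprS.
rewrite -[y * _ * _]mulrA (y_weight_xgpow a n).2 mulrBl.
by rewrite scalerN -scalerAl !exprS -!mulrA.
Qed.

Local Notation omega := (x ^+ 2 * gV).

Lemma omegaX m : omega ^+ m = xgy m.*2 (- m%:Z) 0.
Proof.
rewrite /xgy mulr1 gpowN exprMn_comm -?exprM ?mul2n //.
exact/commr_sym/commrX/commr_sym/comm_xgV.
Qed.

(** The exponents in [x^2 g^-1] are chosen so that [2 * 1/2 - 1 = 0]. *)
Lemma omega_y_weight : (2 : k) != 0 -> y_weight omega 0.
Proof.
move=> n2; have -> : 0 = 2^-1 *+ 2 - 1 :> k.
  by rewrite -[_^-1 *+ _]mulr_natl divff ?subrr.
exact: y_weightM (y_weightX 2 y_weight_x) y_weight_gV.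
Qed.

Lemma comm_omega_jgen i : (2 : k) != 0 -> GRing.comm omega (jgen i).
Proof.
move=> /omega_y_weight[cx cy]; apply: commr_sym; case: i => /=.
- apply: commrM; first exact/commrX/commr_sym/comm_xg.
  by rewrite /GRing.comm mulggV mulgVg.
- by apply: commrM => //; exact/commrX/commr_sym/comm_xgV.
- exact: cx.
by rewrite /GRing.comm cy scale0r subr0.
Qed.

End Relations.

(** * The normal form of an element of J *)

Section NormalFormTheorem.
Variable k : fieldType.
Local Notation V := {malg k[pbw]}.
Local Notation mon := (@mon k).
Local Notation weight := (@weight k).
Local Notation g := (Jg k).
Local Notation gV := (JgV k).
Local Notation x := (Jx k).
Local Notation y := (Jy k).
Implicit Types (z : J k) (v : V).

Lemma JpiM (a b : Jfree k) : \pi_(J k) (a * b) = \pi_(J k) a * \pi_(J k) b.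
Proof. exact: Jpi_mul. Qed.

Lemma JpiB (a b : Jfree k) : \pi_(J k) (a - b) = \pi_(J k) a - \pi_(J k) b.
Proof. by apply: (addIr (\pi_(J k) b)); rewrite -Jpi_add !subrK. Qed.

Lemma Jpi_rel (a b : Jfree k) : Jrel (a - b) -> \pi_(J k) a = \pi_(J k) b.
Proof. by move=> r; apply/Jpi_eq/JidealP; apply: tsi_gen. Qed.

Lemma J_relations : jordan_relations g gV x y.
Proof.
split.
- by have := Jpi_rel (Jrel_ggV k); rewrite JpiM.
- by have := Jpi_rel (Jrel_gVg k); rewrite JpiM.
- by have := Jpi_rel (Jrel_gx k); rewrite !JpiM.
- by have := Jpi_rel (Jrel_gy k); rewrite Jpi_add !JpiM.
- have commutator a b : \pi_(J k) (a * b - b * a) =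
      \pi_(J k) a * \pi_(J k) b - \pi_(J k) b * \pi_(J k) a.
    exact: etrans (JpiB _ _) (congr2 (fun p q => p - q) (JpiM a b) (JpiM b a)).
  rewrite -commutator (Jpi_rel (Jrel_yx k)) Jpi_scale expr2 JpiM //.
Qed.

Lemma JgeneratorE i : Jgenerator k i = jgen g gV x y i.
Proof. by case: i. Qed.

Local Notation gpow := (gpow g gV).
Local Notation xgy := (xgy g gV x y).
Local Notation pbw_eval := (pbw_eval g gV x y).

(** Evaluation is a map of [J]-modules; applied to the monomial [1] it shows
    that every [z] is recovered from [normal_form z], so that the
    [x^a g^n y^b] span [J]. *)
Lemma pbw_eval_act z v : pbw_eval (J_act z v) = z * pbw_eval v.
Proof.
elim/J_ind: z v => [||i z IH|c z z' IH IH'] v.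
- have -> : J_act 0 v = 0.
    by have := J_act_linearl v (-1) 0 0; rewrite scaler0 addr0 scaleN1r addNr.
  by rewrite linear0 mul0r.
- by rewrite J_act1 mul1r.
- by rewrite J_actM J_act_gen (pbw_eval_gen J_relations) IH mulrA JgeneratorE.
- have -> : J_act (c *: z + z') v = c *: J_act z v + J_act z' v.
    exact: J_act_linearl.
  by rewrite [pbw_eval _]linearP /= IH IH' mulrDl scalerAl.
Qed.

Definition normal_form z : V := J_act z (mon 0 0 0).
HB.instance Definition _ :=
  GRing.isLinear.Build k (J k) V *:%R normal_form (J_act_linearl (mon 0 0 0)).

Lemma normal_formK z : pbw_eval (normal_form z) = z.
Proof. by rewrite pbw_eval_act pbw_eval_mon /xgy !mulr1. Qed.

Lemma act_g a n b : J_act g (mon a n b) = mon a (n + 1) b.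
Proof. by rewrite (J_act_gen gen_g) gen_actE. Qed.

Lemma act_gV a n b : J_act gV (mon a n b) = mon a (n - 1) b.
Proof. by rewrite (J_act_gen gen_gV) gen_actE. Qed.

Lemma act_x a n b : J_act x (mon a n b) = mon a.+1 n b.
Proof. by rewrite (J_act_gen gen_x) gen_actE. Qed.

Lemma act_y a n b :
  J_act y (mon a n b) = mon a n b.+1 - weight a n *: mon a.+1 n b.
Proof. by rewrite (J_act_gen gen_y) gen_actE. Qed.

Lemma act_xpow a c n b : J_act (x ^+ a) (mon c n b) = mon (a + c) n b.
Proof.
elim: a => [|a IH]; first by rewrite J_act1.
by rewrite exprS J_actM IH act_x.
Qed.

Lemma act_gpow m a n b : J_act (gpow m) (mon a n b) = mon a (m + n) b.
Proof.
case: m => m /=.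
  elim: m => [|m IH]; first by rewrite J_act1 add0r.
  by rewrite exprS J_actM IH act_g; congr (mon _ _ _); lia.
elim: m => [|m IH].
  by rewrite expr1 act_gV; congr (mon _ _ _); lia.
by rewrite exprS J_actM IH act_gV; congr (mon _ _ _); lia.
Qed.

Lemma act_xgpow a m c n b :
  J_act (x ^+ a * gpow m) (mon c n b) = mon (a + c) (m + n) b.
Proof. by rewrite J_actM act_gpow act_xpow. Qed.

(** Linear independence of the [x^a g^n y^b]. *)
Lemma normal_form_xgy a n b : normal_form (xgy a n b) = mon a n b.
Proof.
rewrite /normal_form J_actM.
suff -> : J_act (y ^+ b) (mon 0 0 0) = mon 0 0 b.
  by rewrite act_xgpow addn0 addr0.
elim: b => [|b IH]; first by rewrite J_act1.
by rewrite exprS J_actM IH act_y weight.unlock mul0r addr0 scale0r subr0.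
Qed.

(** [J_act] with its arguments exchanged, to register linearity in [z]. *)
Definition act_on v z : V := J_act z v.
HB.instance Definition _ v :=
  GRing.isLinear.Build k (J k) V *:%R (act_on v) (J_act_linearl v).

Lemma J_act_normal_form z v : J_act z v =
  \sum_(t <- msupp (normal_form z))
    (normal_form z)@_t *: J_act (xgy t.1.1 t.1.2 t.2) v.
Proof.
rewrite -{1}(normal_formK z) {1}[normal_form z]mon_sum [pbw_eval _]linear_sum.
rewrite -[LHS]/(act_on v _) [act_on v _]linear_sum.
apply: eq_bigr => t _ /=; rewrite [pbw_eval _]linearZ [act_on v _]linearZ /=.
by rewrite pbw_eval_mon.
Qed.

End NormalFormTheorem.

(** * The centre *)

Section Centre.
Variable k : fieldType.
Local Notation V := {malg k[pbw]}.
Local Notation mon := (@mon k).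
Local Notation weight := (@weight k).
Local Notation g := (Jg k).
Local Notation gV := (JgV k).
Local Notation x := (Jx k).
Local Notation y := (Jy k).
Local Notation gpow := (gpow g gV).
Local Notation xgy := (xgy g gV x y).
Local Notation pbw_eval := (pbw_eval g gV x y).
Implicit Types (z : J k) (v : V).

Lemma mcoeff_mon a n b t : (mon a n b)@_t = ((a, n, b) == t)%:R.
Proof. by rewrite mon.unlock mcoeffU. Qed.

Definition ydeg_lt B v := forall a n b, (B <= b)%N -> v@_(a, n, b) = 0.

Lemma ydeg_lt_mon B a n b : (b < B)%N -> ydeg_lt B (mon a n b).
Proof.
move=> ltbB a' n' b' leBb'; rewrite mcoeff_mon; case: eqP => // -[_ _ eb].
by move: (leq_trans ltbB leBb'); rewrite eb ltnn.
Qed.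

Lemma ydeg_lt_linear B c u v :
  ydeg_lt B u -> ydeg_lt B v -> ydeg_lt B (c *: u + v).
Proof.
by move=> du dv a n b le; rewrite mcoeffD mcoeffZ du // dv // mulr0 addr0.
Qed.

Lemma ydeg_lt_map (f : {linear V -> V}) B C v :
  (forall a n b, (b < B)%N -> ydeg_lt C (f (mon a n b))) ->
  ydeg_lt B v -> ydeg_lt C (f v).
Proof.
move=> df dv a n b le; rewrite [v]mon_sum linear_sum raddf_sum.
rewrite big1_seq // => -[[a' n'] b'] /andP[_ tv] /=.
rewrite linearZ /= mcoeffZ; have [ltB|leB] := ltnP b' B.
  by rewrite df // mulr0.
by rewrite dv // mul0r.
Qed.

Lemma ydeg_lt_ex v : exists B, ydeg_lt B v.
Proof.
exists (\max_(t <- msupp v) t.2).+1 => a n b lt.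
apply: mcoeff_outdom; apply/negP => tv.
have := @leq_bigmax_seq _ _ xpredT (fun t : pbw => t.2) _ tv isT.
by rewrite leqNgt lt.
Qed.

(** The two leading terms of [y^(b+1) x]; the second one is the leading term
    of the commutator of [y^(b+1)] with [x]. *)
Lemma act_ypow_x b : exists2 r, ydeg_lt b r &
  J_act (y ^+ b.+1) (mon 1 0 0)
  = mon 1 0 b.+1 - (b.+1%:R / 2) *: mon 2 0 b + r.
Proof.
have e1 : weight 1 0 = 2^-1 by rewrite weight.unlock add0r mul1r.
elim: b => [|b [r dr IH]].
  exists 0; first by move=> a n b _; rewrite mcoeff0.
  by rewrite expr1 act_y e1 mul1r addr0.
exists ((b.+1%:R / 2 * weight 2 0) *: mon 3 0 b + J_act y r).
  apply: ydeg_lt_linear; first exact: ydeg_lt_mon.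
  apply: ydeg_lt_map dr => a n b' lt; rewrite /= act_y addrC -scaleNr.
  by apply: ydeg_lt_linear; apply: ydeg_lt_mon => //; apply: ltnW.
rewrite exprS J_actM IH J_actD J_actB J_actZ !act_y e1.
have regroup (W : lmodType k) (p q s w : W) (h c e : k) :
    p - h *: q - c *: (q - e *: s) + w
    = p - (c + h) *: q + ((c * e) *: s + w).
  rewrite scalerBr scalerA opprB scalerDl opprD !addrA.
  by rewrite [p - h *: q + _ - _]addrAC [p - h *: q - _]addrAC.
have -> : b.+2%:R / 2 = b.+1%:R / 2 + 2^-1 :> k.
  by rewrite -[b.+2%:R]natr1 mulrDl mul1r.
exact: regroup.
Qed.

(** Taking the commutator with [x] lowers the [y]-degree by one, and on leading
    terms it is [x^a g^n y^b |-> - (b/2) x^(a+2) g^n y^(b-1)]. *)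
Lemma mcoeff_commutator_x a n b a' n' b' : (b <= b'.+1)%N ->
  (J_act (xgy a n b) (mon 1 0 0) - mon a.+1 n b)@_(a', n', b')
  = - (b%:R / 2) * ((a.+2, n, b) == (a', n', b'.+1))%:R.
Proof.
move=> le; rewrite J_actM; case: b le => [|b] le.
  by rewrite J_act1 act_xgpow addn1 addr0 subrr mcoeff0 mul0r oppr0 mul0r.
have [r dr ->] := act_ypow_x b.
rewrite J_actD J_actB J_actZ !act_xgpow addn1 addn2 addr0.
rewrite mcoeffB mcoeffD mcoeffB mcoeffZ !mcoeff_mon.
have fr : ydeg_lt b (J_act (x ^+ a * gpow n) r).
  apply: ydeg_lt_map dr => c m b0 lt.
  by rewrite /= act_xgpow; exact: ydeg_lt_mon.
rewrite (fr _ _ _ le).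
by rewrite addr0 addrAC subrr add0r mulNr !xpair_eqE eqSS.
Qed.

Lemma mcoeff_sum_pred1 v t (c : pbw -> k) :
  \sum_(s <- msupp v) v@_s * (c s * (s == t)%:R) = v@_t * c t.
Proof.
have [tv|tNv] := boolP (t \in msupp v).
  rewrite (big_fsetD1 _ tv) /= eqxx mulr1 big_seq big1 ?addr0 // => s.
  by rewrite in_fsetD1 => /andP[/negPf -> _]; rewrite !mulr0.
rewrite (mcoeff_outdom tNv) mul0r big_seq big1 // => s sv.
by case: eqP sv tNv => [-> ->|]; rewrite ?mulr0.
Qed.

Hypothesis char0 : [pchar k] =i pred0.

Lemma natrS_neq0 m : m.+1%:R != 0 :> k.
Proof. by move/pcharf0P: char0 => ->. Qed.

Lemma central_act z u :
  is_central z -> J_act z (normal_form u) = J_act u (normal_form z).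
Proof.
move=> cz; exact: etrans (esym (J_actM z u _))
  (etrans (congr1 (@normal_form k) (cz u)) (J_actM u z _)).
Qed.

(** A leading term of positive [y]-degree would survive in the commutator
    with [x], since [b/2] is nonzero in characteristic zero. *)
Lemma normal_form_central z : is_central z -> ydeg_lt 1 (normal_form z).
Proof.
move=> cz; have [B] := ydeg_lt_ex (normal_form z).
elim: B => [|[|B] IH] // d; first by move=> a n b _; apply: d.
(* The degree is lowered from [B.+2] to [B.+1] by looking at y-degree [B]
   in the commutator with [x]. *)
apply: IH => a n b; rewrite leq_eqVlt => /orP[/eqP <-|]; last exact: d.
have nfx : normal_form x = mon 1 0 0 by exact: act_x.
have := congr1 (mcoeff (a.+2, n, B)) (central_act x cz).
rewrite nfx J_act_normal_form {3}[normal_form z]mon_sum [J_act x _]linear_sum.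
move/eqP; rewrite -subr_eq0 -raddfB -sumrB.
rewrite raddf_sum /= => /eqP sum0; move: sum0.
rewrite (eq_big_seq (fun t => (normal_form z)@_t *
   (- (B.+1%:R / 2) * (t == (a, n, B.+1))%:R))); last first.
  move=> [[a' n'] b'] tz /=; rewrite J_actZ act_x -scalerBr.
  rewrite mcoeffZ mcoeff_commutator_x; last first.
    rewrite -ltnS ltnNge; apply: contraL tz => le.
    by rewrite -mcoeff_eq0 d.
  by rewrite !xpair_eqE !eqSS; case: (b' =P _) => [->|_]; rewrite ?andbF ?mulr0.
move/eqP; rewrite (mcoeff_sum_pred1 (normal_form z) (a, n, B.+1) (fun=> _)).
rewrite mulf_eq0 oppr_eq0 mulf_eq0 invr_eq0 !(negPf (natrS_neq0 _)) !orbF.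
by move/eqP.
Qed.

(** Once no [y] is left, the commutator with [y] multiplies [x^a g^n] by [x]
    times its weight, so only monomials of weight zero can occur. *)
Lemma normal_form_central_support z a n b : is_central z ->
  (a, n, b) \in msupp (normal_form z) -> b = 0%N /\ weight a n = 0.
Proof.
move=> cz tz; have d := normal_form_central cz.
have d0 a' n' b' : (a', n', b') \in msupp (normal_form z) -> b' = 0%N.
  case: b' => // b' tz'; move: (tz').
  by rewrite -mcoeff_neq0 d ?eqxx.
split; first exact: d0 tz.
have nfy : normal_form y = mon 0 0 1.
  rewrite /normal_form act_y.
  have -> : weight 0 0 = 0 by rewrite weight.unlock mul0r addr0.
  by rewrite scale0r subr0.
have := congr1 (mcoeff (a.+1, n, 0%N)) (central_act y cz).
rewrite nfy J_act_normal_form {3}[normal_form z]mon_sum [J_act y _]linear_sum.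
rewrite !raddf_sum /=.
rewrite big_seq big1 => [|[[a' n'] b'] tz']; last first.
  rewrite mcoeffZ /= (d0 _ _ _ tz') J_actM J_act1 act_xgpow mcoeff_mon.
  by rewrite !xpair_eqE andbF mulr0.
rewrite (eq_big_seq (fun t => (normal_form z)@_t *
   (- weight t.1.1 t.1.2 * (t == (a, n, 0%N))%:R)));
  last move=> [[a' n'] b'] tz'; last first.
  rewrite J_actZ act_y /= mcoeffZ mcoeffB mcoeffZ !mcoeff_mon.
  by rewrite !xpair_eqE !eqSS andbF sub0r mulNr.
rewrite mcoeff_sum_pred1 => /esym/eqP; rewrite mulf_eq0 oppr_eq0.
by rewrite -(d0 _ _ _ tz) -[_ == 0]negbK mcoeff_neq0 tz => /eqP.
Qed.

Lemma intr_eq0_pchar0 (m : int) : (m%:~R == 0 :> k) = (m == 0).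
Proof.
have n0 : forall n : nat, (n%:R == 0 :> k) = (n == 0%N) by exact/pcharf0P.
by case: m => m; rewrite ?NegzE ?mulrNz ?oppr_eq0 n0.
Qed.

Lemma weight_eq0 a n : weight a n = 0 -> n = - (a./2)%:Z /\ a = a./2.*2.
Proof.
move=> e0; have n2 := natrS_neq0 1.
suff : n * 2 + a%:Z = 0 by lia.
apply/eqP; rewrite -intr_eq0_pchar0 intrD intrM.
have -> : n%:~R * 2%:~R + a%:Z%:~R = weight a n * 2 :> k.
  by rewrite weight.unlock mulrDl divfK.
by rewrite e0 mul0r.
Qed.

Local Notation Omega := (Omega k).

Lemma OmegaX m : Omega ^+ m = xgy m.*2 (- m%:Z) 0.
Proof. exact: (omegaX (J_relations k)). Qed.

Lemma Omega_central : is_central Omega.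
Proof.
move=> w; elim/J_ind: w => [||i z IH|c z z' IH IH'].
- exact: commr0.
- exact: commr1.
- rewrite JgeneratorE; apply: commrM IH.
  exact: (comm_omega_jgen (J_relations k) i (natrS_neq0 1)).
- by apply: commrD IH'; rewrite /GRing.comm -scalerAr -scalerAl IH.
Qed.

Lemma horner_alg_sum p :
  horner_alg Omega p = \sum_(i < size p) p`_i *: Omega ^+ i.
Proof.
rewrite -{1}[p]coefK poly_def linear_sum; apply: eq_bigr => i _ /=.
by rewrite linearZ /= rmorphXn /= horner_algX mulr_algl.
Qed.

Lemma horner_alg_central p : is_central (horner_alg Omega p).
Proof.
move=> w; apply: commr_sym; rewrite horner_alg_sum; apply: commr_sum => i _.
have c : GRing.comm w (Omega ^+ i) by exact/commrX/commr_sym/Omega_central.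
by rewrite /GRing.comm -scalerAr -scalerAl c.
Qed.

Lemma central_horner_alg z :
  is_central z -> exists p, z = horner_alg Omega p.
Proof.
move=> cz; set v := normal_form z.
exists (\sum_(t <- msupp v) v@_t *: 'X^(t.1.1./2)).
rewrite -{1}[z]normal_formK -/v {1}[v]mon_sum [pbw_eval _]linear_sum.
rewrite linear_sum /=.
rewrite big_seq [RHS]big_seq; apply: eq_bigr => -[[a n] b] tz /=.
rewrite [pbw_eval _]linearZ linearZ /= pbw_eval_mon rmorphXn /= horner_algX.
rewrite mulr_algl OmegaX.
have [b0 /weight_eq0[n0 a0]] := normal_form_central_support cz tz.
by rewrite b0 -a0 -n0.
Qed.

(** The powers of [Omega] are distinct basis monomials, so the coefficients of
    [p] can be read off from the normal form. *)
Lemma mcoeff_normal_form_Omega p i :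
  (normal_form (horner_alg Omega p))@_(i.*2, - i%:Z, 0%N) = p`_i.
Proof.
have -> : p`_i = \sum_(j < size p) p`_j * (i == j)%:R.
  rewrite -{1}[p]coefK poly_def coef_sum; apply: eq_bigr => j _.
  by rewrite coefZ coefXn.
rewrite horner_alg_sum [normal_form _]linear_sum raddf_sum.
apply: eq_bigr => j _ /=.
rewrite [normal_form _]linearZ /= mcoeffZ OmegaX normal_form_xgy mcoeff_mon.
congr (_ * _%:R); rewrite !xpair_eqE eqxx andbT; lia.
Qed.

Lemma horner_alg_Omega_inj : injective (horner_alg Omega).
Proof.
move=> p q pq; apply/polyP => i.
by rewrite -!mcoeff_normal_form_Omega pq.
Qed.

End Centre.

Theorem lemma3p1 (k : closedFieldType) (char0 : [pchar k] =i pred0) :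
  (forall z : J k,
      is_central z <-> exists p : {poly k}, z = horner_alg (Omega k) p) /\
  injective (horner_alg (Omega k)).
Proof.
split; last exact: horner_alg_Omega_inj.
move=> z; split; first exact: central_horner_alg.
by move=> [p ->]; exact: horner_alg_central.
Qed.
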